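(* Let $G=G_1*\cdots*G_k$ with $G_i\cong\mathbb{Z}^{n_i}$, $n_i\in\mathbb{N}$. Let $\delta,\delta'\in\mathrm{Aut}(G)$ be separating Dehn twists with associated splittings $G=A*_C B$ (with twisting element $c_0\in C$) and $G=A'*_{C'}B'$ (with twisting element $c_0'\in C'$), respectively, both chosen as in the standing assumptions of the context. Then $\delta$ and $\delta'$ are conjugate in $\mathrm{Aut}(G)$ if and only if there are isomorphisms $\phi_A:A\to A'$ and $\phi_B:B\to B'$ such that: (1) $\phi_A(C)=C'$; (2) $\phi_B(C)=C'$; (3) $\phi_A|_C=\phi_B|_C$; (4) $\phi_A(c_0)=\phi_B(c_0)=c_0'$.
   Context: $\delta$ is the separating Dehn twist of $G=A*_C B$ ($C$ abelian) with twisting element $c_0\in C$ if $\delta|_A=\mathrm{id}_A$ and $\delta(b)=c_0bc_0^{-1}$ for all $b\in B$; similarly for $\delta'$ with $G=A'*_{C'}B'$ and $c_0'\in C'$. Standing assumptions on the splittings: $c_0\neq1$; $A=\mathrm{Fix}(\delta)$, the subgroup of all elements fixed by $\delta$; $C$ is maximal abelian in $G$; $A$ and $B$ are non-abelian. The same is assumed for the primed data. With these splittings the mapping tori $\Gamma_\delta=\langle G,t\mid tgt^{-1}=\delta(g)\ \forall g\in G\rangle$ and $\Gamma_{\delta'}$ (with stable letter $t'$) decompose as $\Gamma_\delta=(A\oplus\langle t\rangle)*_{C\oplus\langle t\rangle}(B\oplus\langle t_1\rangle)$ with $t_1=c_0^{-1}t$, and $\Gamma_{\delta'}=(A'\oplus\langle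 t'\rangle)*_{C'\oplus\langle t'\rangle}(B'\oplus\langle t_1'\rangle)$ with $t_1'=c_0'^{-1}t'$. *)

(* Defs.v *)
From HB Require Import structures.
From mathcomp Require Import all_boot all_algebra.
From mathcomp Require Import mathcomp_extra boolp classical_sets functions.

Set Implicit Arguments.
Unset Strict Implicit.
Unset Printing Implicit Defensive.

Local Open Scope classical_set_scope.
Local Open Scope group_scope.

(* Groups are [groupType]s, possibly infinite, and the subgroups of G are     *)
(* sets [A : set G] closed under the group operations.                        *)

Definition is_subgroup (G : groupType) (A : set G) : Prop :=
  group_closed [in A].

Definition abelian_set (G : groupType) (A : set G) : Prop :=
  {in A &, forall x y, commute x y}.

Definition maximal_abelian (G : groupType) (C : set G) : Prop :=
  [/\ is_subgroup C, abelian_set C &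
      forall D : set G,
        is_subgroup D -> abelian_set D -> C `<=` D -> D = C].

(* A homomorphism from a subgroup A of G to H is represented by a total       *)
(* function on G, of which only the restriction to A matters.                 *)
Definition hom_on (G H : groupType) (A : set G) (f : G -> H) : Prop :=
  {in A &, {morph f : x y / x * y >-> x * y}}.

Definition iso_on (G H : groupType) (A : set G) (A' : set H) (f : G -> H) :
  Prop := hom_on A f /\ set_bij A A' f.

Definition iso_to_Zn (G : groupType) (n : nat) (A : set G) : Prop :=
  exists f : 'rV[int]_n -> G,
    {morph f : u v / (u + v)%R >-> u * v} /\ set_bij [set: 'rV[int]_n] A f.

(* Internal decompositions of G, expressed by the universal properties of the *)
(* free product and of the amalgamated free product (the pushout of the two   *)
(* inclusions of C into A and B).                                             *)

Definition is_free_product (G : groupType) (k : nat) (Gs : 'I_k -> set G) :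
  Prop :=
  (forall i, is_subgroup (Gs i)) /\
  forall (H : groupType) (f : 'I_k -> G -> H),
    (forall i, hom_on (Gs i) (f i)) ->
    exists! F : G -> H,
      hom_on [set: G] F /\ forall i, {in Gs i, F =1 f i}.

Definition is_amalgam (G : groupType) (A B C : set G) : Prop :=
  [/\ is_subgroup A, is_subgroup B, is_subgroup C, C `<=` A & C `<=` B] /\
  forall (H : groupType) (f g : G -> H),
    hom_on A f -> hom_on B g -> {in C, f =1 g} ->
    exists! F : G -> H,
      [/\ hom_on [set: G] F, {in A, F =1 f} & {in B, F =1 g}].

Definition automorphism (G : groupType) (f : G -> G) : Prop :=
  iso_on [set: G] [set: G] f.

Definition conjugate_in_Aut (G : groupType) (d d' : G -> G) : Prop :=
  exists p q : G -> G,
    [/\ automorphism p, cancel p q, cancel q p & d' =1 p \o d \o q].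

Definition Fix (G : groupType) (f : G -> G) : set G := [set g | f g = g].

Definition separating_Dehn_twist (G : groupType)
    (A B C : set G) (c0 : G) (d : G -> G) : Prop :=
  [/\ is_amalgam A B C, abelian_set C & c0 \in C] /\
  [/\ automorphism d, {in A, forall a, d a = a} &
      {in B, forall b, d b = c0 * b * c0^-1}].

Definition standing_assumptions (G : groupType)
    (A B C : set G) (c0 : G) (d : G -> G) : Prop :=
  [/\ c0 <> 1, A = Fix d, maximal_abelian C,
      ~ abelian_set A & ~ abelian_set B].

(* Main.v *)
(* From left to right, the automorphism conjugating delta to delta' is, up to *)
(* an inner automorphism by an element of A, both phi_A and phi_B. Put        *)
(* Z_x = {g | delta g = x g x^-1}. Writing g in reduced form in A *_C B and   *)
(* cancelling in the middle of x g x^-1 (delta g)^-1 = 1 shows that, if Z_x   *)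
(* is not contained in A for an x in A, then x is conjugate in A to an        *)
(* element of C, and that such an x in C other than 1 is c0, with Z_c0 = B.   *)
(* If q conjugates delta' to delta, q(B') lies in Z_(q c0') and not in A,     *)
(* hence a (q c0') a^-1 = c0 for some a in A, and C and B are then recovered  *)
(* from c0 as its centralizer and as Z_c0.                                    *)
(*                                                                            *)
(* This uses that C is malnormal. G is represented in GL_2 over Q(s): G_i is  *)
(* sent to matrices diagonal in the basis (i+s,1), (i-s,1), with eigenvalues  *)
(* 1 and a positive rational u(x), where u embeds Z^n in Q^* through primes.  *)
(* Up to a power of 2s, the image of a reduced word w has polynomial entries, *)
(* and its value at s = 0 is a non-zero multiple of (i,1)^T (1,-j), i and j   *)
(* being the indices of the first and last letters of w. So the image of      *)
(* g <> 1 has distinct eigenvalues and the image of any g has non-zero trace: *)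
(* for w cyclically reduced, both can be read at s = 0. Hence the centralizer *)
(* of x <> 1 is abelian, and an element conjugating x to another element of   *)
(* its centralizer commutes with x.                                           *)

Require Import Defs.
From HB Require Import structures.
From mathcomp Require Import all_boot all_order all_algebra.
From mathcomp Require Import mathcomp_extra boolp classical_sets functions.
From mathcomp Require Import ring.

Set Implicit Arguments.
Unset Strict Implicit.
Unset Printing Implicit Defensive.

Import Order.TTheory GRing.Theory Num.Theory.

Local Open Scope classical_set_scope.
Local Open Scope group_scope.

(** * Permutation groups and generation *)

(** If [phiA] and [phiB] agree on C, they glue by the universal property to an endomorphism p of G,
    their inverses glue to its inverse, and p intertwines the two twists because it carries [c0] to
    [c0']: this is [twist_conjugate].

    Conversely, a conjugator carries fixed points to fixed points, hence A to A'.
    [twist_conj_elements] corrects it by an element of A so that the twisting elements match; then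
    [twist_conj_c0_B] recovers B and [malnormal_commute] recovers C. This rests on reduced forms in
    the amalgam ([ends_in_B_reduced]) and on malnormality of C ([maximal_abelian_malnormal]), itself
    drawn from the representation [free_product_Zn_rep].

    Free products and amalgams are given only through homomorphisms into arbitrary groups. The
    groups [sym X] serve as targets: generation, the representation and reduced forms all come from
    suitable permutation actions. *)

Record sym (X : Type) := Sym {
  sym_fun :> X -> X;
  sym_inv : X -> X;
  sym_funK : cancel sym_fun sym_inv;
  sym_invK : cancel sym_inv sym_fun }.

HB.instance Definition _ X := gen_eqMixin (sym X).
HB.instance Definition _ X := gen_choiceMixin (sym X).

Section SymGroup.
Variable X : Type.
Implicit Types f g h : sym X.

Lemma symP f g : f =1 g -> f = g.
Proof.
case: f g => [f f' fK f'K] [g g' gK g'K] /= /funext fg; subst g.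
have fg' : f' = g' by apply: funext => x; rewrite -{1}[x]g'K fK.
by subst g'; congr Sym; apply: Prop_irrelevance.
Qed.

Definition sym_one := @Sym X id id (frefl _) (frefl _).
Definition sym_mul f g :=
  Sym (can_comp (sym_funK f) (sym_funK g))
      (can_comp (sym_invK g) (sym_invK f)).
Definition sym_opp f := Sym (sym_invK f) (sym_funK f).

Fact sym_mulA : associative sym_mul.
Proof. by move=> f g h; exact: symP. Qed.
Fact sym_mul1 : left_id sym_one sym_mul.
Proof. by move=> f; exact: symP. Qed.
Fact sym_mulr1 : right_id sym_one sym_mul.
Proof. by move=> f; exact: symP. Qed.
Fact sym_mulV : left_inverse sym_one sym_opp sym_mul.
Proof. by move=> f; apply: symP => x; exact: sym_funK. Qed.
Fact sym_mulrV : right_inverse sym_one sym_opp sym_mul.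
Proof. by move=> f; apply: symP => x; exact: sym_invK. Qed.

HB.instance Definition _ :=
  isGroup.Build (sym X) sym_mulA sym_mul1 sym_mulr1 sym_mulV sym_mulrV.

Lemma symM f g x : (f * g) x = f (g x). Proof. by []. Qed.
Lemma sym1 x : (1 : sym X) x = x. Proof. by []. Qed.

End SymGroup.

Section Subgroups.
Variables (G : groupType) (A : set G).
Hypothesis sA : is_subgroup A.

Lemma subgroup1 : A 1. Proof. by case: sA => /set_mem. Qed.
Lemma subgroupV x : A x -> A x^-1.
Proof. by move=> Ax; apply/set_mem/(group_closedV sA)/mem_set. Qed.
Lemma subgroupM x y : A x -> A y -> A (x * y).
Proof. by move=> Ax Ay; apply/set_mem/(group_closedM sA); exact/mem_set. Qed.
Lemma subgroupMl x y : A x -> A (x * y) -> A y.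
Proof.
by move=> Ax Axy; rewrite -(mulKg x y); apply/subgroupM/Axy/subgroupV.
Qed.
Lemma subgroupMr x y : A x -> A (y * x) -> A y.
Proof.
by move=> Ax Ayx; rewrite -(mulgK x y); apply/subgroupM/subgroupV/Ax.
Qed.
Lemma subgroup_invE x : A x^-1 -> A x.
Proof. by move/subgroupV; rewrite invgK. Qed.
End Subgroups.

Lemma is_subgroupI (G : groupType) (A : set G) :
  A 1 -> (forall x, A x -> A x^-1) -> (forall x y, A x -> A y -> A (x * y)) ->
  is_subgroup A.
Proof.
move=> A1 AV AM; split; first exact/mem_set.
by move=> x y /set_mem Ax /set_mem Ay; apply/mem_set/AM/AV.
Qed.

Section HomOn.
Variables (G H : groupType) (A : set G) (f : G -> H).
Hypotheses (sA : is_subgroup A) (fM : hom_on A f).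

Lemma hom_onM x y : A x -> A y -> f (x * y) = f x * f y.
Proof. by move=> Ax Ay; apply: fM; exact/mem_set. Qed.
Lemma hom_on1 : f 1 = 1.
Proof.
have A1 := subgroup1 sA.
by apply: (@mulgI _ (f 1)); rewrite -hom_onM // !mulg1.
Qed.
Lemma hom_onV x : A x -> f x^-1 = (f x)^-1.
Proof.
move=> Ax; apply: (@mulgI _ (f x)); rewrite -hom_onM //; last exact: subgroupV.
by rewrite !mulgV hom_on1.
Qed.
End HomOn.

Lemma is_subgroupT (G : groupType) : is_subgroup [set: G].
Proof. exact: is_subgroupI. Qed.

Section Generation.
Variables (G : groupType) (S : set G).
Hypothesis sS : is_subgroup S.

Definition left_mul (g : G) : sym (G * bool).
Proof.
exists (fun p => (g * p.1, p.2)) (fun p => (g^-1 * p.1, p.2)).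
- by move=> [x b]; rewrite /= mulKg.
- by move=> [x b]; rewrite /= mulVKg.
Defined.

Definition flip : sym (G * bool).
Proof.
pose f (p : G * bool) := (p.1, `[< S p.1 >] (+) p.2).
by exists f f => -[x b]; rewrite /f /= addbA addbb.
Defined.

(* The left regular action on two copies of G agrees on [S] with its          *)
(* conjugate by the exchange of the two copies of [S], but not outside [S].   *)
Lemma epi_subgroupT :
  (forall f g : G -> sym (G * bool), hom_on [set: G] f -> hom_on [set: G] g ->
     {in S, f =1 g} -> f = g) ->
  forall g, S g.
Proof.
move=> epi g.
pose f2 x := flip * left_mul x * flip.
have lM : {morph left_mul : x y / x * y}.
  by move=> x y; apply: symP => -[z b]; rewrite /= mulgA.
have flipK : flip * flip = 1 by apply: symP => p; exact: (sym_funK flip).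
have E : left_mul = f2.
  apply: epi => [x y _ _|x y _ _|x /set_mem Sx]; first exact: lM.
    by rewrite /f2 lM !mulgA -[_ * flip * flip]mulgA flipK mulg1.
  apply: symP => -[z b] /=; congr pair.
  suff -> : `[< S (x * z) >] = `[< S z >] by rewrite addbA addbb.
  by apply: asbool_equiv_eq; split; [exact: subgroupMl|exact: subgroupM].
(* Since 1 lies in [S], the conjugated action sends [(1, false)] to a pair with second component
   [S g (+) true], while [left_mul g] keeps [false]; equality forces [S g]. *)
have := congr1 (fun h : sym (G * bool) => (h (1, false)).2) (congr1 (@^~ g) E).
rewrite /= mulg1 (asboolT (subgroup1 sS)) /=.
by case: asboolP.
Qed.
End Generation.

(** The elements whose left multiplication, and that of their inverse, preserve P form a subgroup
    containing the factors. Homomorphisms agreeing on it coincide by uniqueness in the universal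
    property, so [epi_subgroupT] makes it all of G. *)
Lemma free_product_ind (G : groupType) (k : nat) (Gs : 'I_k -> set G)
    (P : set G) :
  is_free_product Gs -> P 1 ->
  (forall i x g, Gs i x -> P g -> P (x * g)) -> forall g, P g.
Proof.
move=> [sGs univ] P1 PM g.
pose S := [set g | forall h, (P h -> P (g * h)) /\ (P h -> P (g^-1 * h))].
have sS : is_subgroup S.
  apply: is_subgroupI.
  - by move=> h; rewrite invg1 mul1g.
  - by move=> x Sx h; rewrite invgK; have [? ?] := Sx h.
  - move=> x y Sx Sy h; rewrite invgM -!mulgA.
    by split=> Ph; [apply Sx, Sy|apply Sy, Sx].
suff /(_ 1) [+ _] : S g by rewrite mulg1; exact.
move: g; apply: (epi_subgroupT sS) => f1 f2 f1M f2M E.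
have [i x y|F [_ Fu]] := univ _ (fun _ => f1).
  by move=> _ _; apply: f1M; rewrite inE.
rewrite -[RHS]Fu; first by apply/esym/Fu; split.
split=> // i x /set_mem Gx; rewrite E //; apply/mem_set => h.
by split; apply: (PM i) => //; exact: (subgroupV (sGs i)).
Qed.

Lemma amalgam_ind (G : groupType) (A B C : set G) (P : set G) :
  is_amalgam A B C -> P 1 ->
  (forall x g, A x -> P g -> P (g * x)) ->
  (forall x g, B x -> P g -> P (g * x)) -> forall g, P g.
Proof.
move=> [[sA sB sC CA CB] univ] P1 PA PB g.
pose S := [set g | forall h, (P h -> P (h * g)) /\ (P h -> P (h * g^-1))].
have sS : is_subgroup S.
  apply: is_subgroupI.
  - by move=> h; rewrite invg1 mulg1.
  - by move=> x Sx h; rewrite invgK; have [? ?] := Sx h.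
  - move=> x y Sx Sy h; rewrite invgM !mulgA.
    by split=> Ph; [apply Sy, Sx|apply Sx, Sy].
suff /(_ 1) [+ _] : S g by rewrite mul1g; exact.
move: g; apply: (epi_subgroupT sS) => f1 f2 f1M f2M E.
have hom1 D : hom_on D f1 by move=> x y _ _; apply: f1M; rewrite inE.
have [F [_ Fu]] := univ _ f1 f1 (hom1 A) (hom1 B) (fun _ _ => erefl).
rewrite -[RHS]Fu; first by apply/esym/Fu; split.
split=> // x /set_mem Dx; rewrite E //; apply/mem_set => h.
- by split; apply: PA => //; exact: (subgroupV sA).
- by split; apply: PB => //; exact: (subgroupV sB).
Qed.

(** * Embedding Z^n in the positive rationals *)

Lemma set_bijK (T U : Type) (x0 : T) (A : set T) (B : set U) (f : T -> U) :
  set_bij A B f ->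
  exists g : U -> T, (forall x, A x -> g (f x) = x) /\
    (forall y, B y -> A (g y) /\ f (g y) = y).
Proof.
move=> [fAB f_inj f_surj].
have /choice[g gP] : forall y, exists x, B y -> A x /\ f x = y.
  move=> y; have [/f_surj[x Ax <-]|nBy] := pselect (B y); first by exists x.
  by exists x0.
exists g; split=> // x Ax; have [Agx fgx] := gP _ (fAB _ Ax).
by apply: f_inj; rewrite ?inE.
Qed.

(** Some strictly increasing sequence of primes, not necessarily all of them. *)
Fixpoint nth_prime (m : nat) : nat :=
  if m is m'.+1 then s2val (prime_above (nth_prime m')) else 2%N.

Lemma prime_nth_prime m : prime (nth_prime m).
Proof. by case: m => [|m] //=; case: prime_above. Qed.

Lemma nth_prime_inj : injective nth_prime.
Proof.
have mono : {homo nth_prime : m n / (m < n)%N}.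
  apply: homo_ltn => [x y z|m] /=; first exact: ltn_trans.
  by case: prime_above.
move=> m n E; case: (ltngtP m n) => // /mono; first by rewrite E ltnn.
by rewrite E ltnn.
Qed.

Lemma logn_prod_nth_prime n (a : 'I_n -> nat) (i : 'I_n) :
  logn (nth_prime i) (\prod_(j < n) nth_prime j ^ a j) = a i.
Proof.
have pos (P : pred 'I_n) : (0 < \prod_(j < n | P j) nth_prime j ^ a j)%N.
  by apply: prodn_cond_gt0 => j _; rewrite expn_gt0 prime_gt0 ?prime_nth_prime.
rewrite (bigD1 i) //= lognM ?pos ?expn_gt0 ?prime_gt0 ?prime_nth_prime //.
rewrite lognX logn_prime ?prime_nth_prime // eqxx muln1.
rewrite (_ : logn _ _ = 0%N) ?addn0 //.
elim/big_rec: _ => [|j x ji x0]; first by rewrite logn1.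
have [->|x_gt0] := posnP x; first by rewrite muln0 logn0.
have p_gt0 : (0 < nth_prime j ^ a j)%N.
  by rewrite expn_gt0 prime_gt0 ?prime_nth_prime.
rewrite (lognM _ p_gt0 x_gt0) x0 addn0 lognX logn_prime ?prime_nth_prime //.
by rewrite (inj_eq nth_prime_inj) eq_sym (negbTE (ji : val j != val i)) muln0.
Qed.

Lemma Zn_to_rat n : exists f : 'rV[int]_n -> rat,
  [/\ forall v, (0 < f v)%R, {morph f : u v / (u + v)%R >-> (u * v)%R} &
      forall v, f v = 1%R -> v = 0%R].
Proof.
pose p (j : 'I_n) : rat := ((nth_prime j)%:R)%R.
have p_gt0 j : (0 < p j)%R by rewrite ltr0n prime_gt0 ?prime_nth_prime.
exists (fun v => \prod_j p j ^ v ord0 j)%R; split=> [v|u v|v].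
- by apply: prodr_gt0 => j _; exact: exprz_gt0.
- rewrite -big_split; apply: eq_bigr => j _ /=.
  by rewrite mxE expfzDr // gt_eqF.
(* Positive and negative parts of [v]: clearing denominators turns [f v = 1] into an equality of
   natural numbers, whose valuations are compared. *)
pose a j := if v ord0 j is Posz m then m else 0%N.
pose b j := if v ord0 j is Negz m then m.+1 else 0%N.
have E : (\prod_j p j ^ v ord0 j * \prod_j p j ^+ b j = \prod_j p j ^+ a j)%R.
  rewrite -big_split; apply: eq_bigr => j _ /=; rewrite /a /b.
  case: (v _ j) => m; first by rewrite expr0 mulr1.
  by rewrite NegzE expr0 -exprnN mulVf // expf_neq0 // gt_eqF.
move=> f1; move: E; rewrite f1 mul1r.
have natE c : (\prod_j p j ^+ c j = (\prod_(j < n) nth_prime j ^ c j)%N%:R)%R.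
  by rewrite natr_prod; apply: eq_bigr => j _; rewrite natrX.
rewrite !natE => /eqP; rewrite eqr_nat => /eqP E.
apply/rowP => j; rewrite mxE; have := congr1 (logn (nth_prime j)) E.
by rewrite !logn_prod_nth_prime /a /b; case: (v _ j) => [m|m] //= <-.
Qed.

Lemma iso_to_Zn_rat (G : groupType) n (A : set G) :
  iso_to_Zn n A -> exists u : G -> rat,
  [/\ forall x, (0 < u x)%R,
      forall x y, A x -> A y -> u (x * y) = (u x * u y)%R &
      forall x, A x -> u x = 1%R -> x = 1].
Proof.
move=> [f [fM fbij]]; have [f_A _ _] := fbij.
have [g [fK gK]] := set_bijK 0%R fbij.
have [h [h_gt0 hM h1]] := Zn_to_rat n.
exists (h \o g); split=> [x|x y Ax Ay|x Ax] /=; first exact: h_gt0.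
  rewrite -hM; congr h; have [_ {1}<-] := gK _ Ax; have [_ {1}<-] := gK _ Ay.
  by rewrite -fM fK.
move/h1 => gx; have [_ <-] := gK _ Ax; rewrite gx.
by apply: (@mulgI _ (f 0%R)); rewrite -fM addr0 mulg1.
Qed.

(** * Two by two matrices *)

Section Matrix2.
Local Open Scope ring_scope.

Definition mx2 (R : Type) (a b c d : R) : 'M[R]_2 :=
  \matrix_(i, j) if i == 0 then if j == 0 then a else b
                 else if j == 0 then c else d.

Lemma ord2_ind (P : 'I_2 -> Prop) : P 0 -> P 1 -> forall i, P i.
Proof.
move=> P0 P1 [[|[|//]] lti].
  by rewrite (_ : Ordinal lti = 0) //; exact: val_inj.
by rewrite (_ : Ordinal lti = 1) //; exact: val_inj.
Qed.

Lemma mx2P (R : Type) (M : 'M[R]_2) : M = mx2 (M 0 0) (M 0 1) (M 1 0) (M 1 1).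
Proof.
apply/matrixP => i j; rewrite mxE.
by elim/ord2_ind: i; elim/ord2_ind: j.
Qed.

Section Ring.
Variable R : comNzRingType.
Implicit Types (a b c d : R) (M N : 'M[R]_2).

Lemma mx2M a b c d a' b' c' d' :
  mx2 a b c d *m mx2 a' b' c' d' =
  mx2 (a * a' + b * c') (a * b' + b * d') (c * a' + d * c') (c * b' + d * d').
Proof.
rewrite [LHS]mx2P; congr mx2; by rewrite !mxE !big_ord_recl big_ord0 !mxE addr0.
Qed.
Lemma mx2Z x a b c d : x *: mx2 a b c d = mx2 (x * a) (x * b) (x * c) (x * d).
Proof. by rewrite [LHS]mx2P; congr mx2; rewrite !mxE. Qed.
Lemma mx2D a b c d a' b' c' d' :
  mx2 a b c d + mx2 a' b' c' d' = mx2 (a + a') (b + b') (c + c') (d + d').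
Proof. by rewrite [LHS]mx2P; congr mx2; rewrite !mxE. Qed.
Lemma mx2_scalar x : x%:M = mx2 x 0 0 x :> 'M[R]_2.
Proof. by rewrite [LHS]mx2P; congr mx2; rewrite !mxE. Qed.
Lemma mx2_tr a b c d : \tr (mx2 a b c d) = a + d.
Proof. by rewrite /mxtrace !big_ord_recl big_ord0 !mxE addr0. Qed.
Lemma mx2_det a b c d : \det (mx2 a b c d) = a * d - b * c.
Proof.
rewrite (expand_det_row _ 0) !big_ord_recl big_ord0 /cofactor !det_mx11 !mxE /=.
ring.
Qed.
Lemma mx2_inj a b c d a' b' c' d' :
  mx2 a b c d = mx2 a' b' c' d' -> [/\ a = a', b = b', c = c' & d = d'].
Proof.
move=> /matrixP E; split.
- by move: (E 0 0); rewrite !mxE.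
- by move: (E 0 1); rewrite !mxE.
- by move: (E 1 0); rewrite !mxE.
- by move: (E 1 1); rewrite !mxE.
Qed.
End Ring.

Lemma map_mx2 (R S : Type) (f : R -> S) a b c d :
  map_mx f (mx2 a b c d) = mx2 (f a) (f b) (f c) (f d).
Proof. by rewrite [LHS]mx2P; congr mx2; rewrite !mxE. Qed.

(** The discriminant of the characteristic polynomial, non-zero when the eigenvalues are
    distinct. *)
Definition disc (R : comNzRingType) (M : 'M[R]_2) :=
  (\tr M) ^+ 2 - 4%:R * \det M.
End Matrix2.

(** * Commuting and conjugate matrices *)

Section Commutation.
Local Open Scope ring_scope.
Variable F : fieldType.
Implicit Types (M N X Y H : 'M[F]_2).

Lemma eq_of_subE (x y u v : F) : u = v -> x - y = u - v -> x = y.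
Proof. by move=> ->; rewrite subrr => /subr0_eq. Qed.

Lemma discE (R : comNzRingType) (a b c d : R) :
  disc (mx2 a b c d) = (a - d) ^+ 2 + 4%:R * (b * c).
Proof. by rewrite /disc mx2_tr mx2_det; ring. Qed.

(** The centralizer of a non-scalar matrix X is F[X]. One of b, c, a - d is non-zero, and y is the
    quotient by it of the corresponding entry of Y. *)
Lemma commute_mx2 X Y : disc X != 0 -> X *m Y = Y *m X ->
  exists x y, Y = x%:M + y *: X.
Proof.
rewrite [X]mx2P [Y]mx2P !mx2M; move: (X 0 0) (X 0 1) (X 1 0) (X 1 1) => a b c d.
move: (Y 0 0) (Y 0 1) (Y 1 0) (Y 1 1) => e f g h.
rewrite discE => dX /mx2_inj[E1 E2 E3 _].
suff [y [fE gE hE]] : exists y, [/\ f = y * b, g = y * c & h = e - y * (a - d)].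
  exists (e - y * a), y; rewrite mx2_scalar mx2Z mx2D fE gE hE.
  by congr mx2; ring.
have [b0|b0] := eqVneq b 0; last first.
  exists (f / b); split; first by rewrite divfK.
    by apply: (mulfI b0); apply: (eq_of_subE E1); field.
  by apply: (mulfI b0); apply: (eq_of_subE E2); field.
have [c0|c0] := eqVneq c 0; last first.
  exists (g / c); split; last 2 first.
  - by rewrite divfK.
  - by apply: (mulfI c0); apply: (eq_of_subE (esym E3)); field.
  - by apply: (mulfI c0); apply: (eq_of_subE (esym E1)); field.
have ad0 : a - d != 0 by apply: contra_neq dX => ->; rewrite b0; ring.
exists ((e - h) / (a - d)); split.
- by apply: (mulfI ad0); apply: (eq_of_subE E2); rewrite b0; field.
- by apply: (mulfI ad0); apply: (eq_of_subE (esym E3)); rewrite c0; field.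
- by field.
Qed.

Lemma commute_mx2_trans X Y Z : disc X != 0 ->
  X *m Y = Y *m X -> X *m Z = Z *m X -> Y *m Z = Z *m Y.
Proof.
move=> dX /(commute_mx2 dX)[x [y ->]] XZ.
rewrite mulmxDl mulmxDr -scalemxAl -scalemxAr XZ.
by rewrite mul_scalar_mx mul_mx_scalar.
Qed.

Lemma disc_conj M N X : M *m N = 1%:M -> disc (M *m X *m N) = disc X.
Proof.
move=> MN; rewrite /disc mxtrace_mulC mulmxA (mulmx1C MN) mul1mx.
rewrite !det_mulmx mulrAC -det_mulmx MN det1.
by rewrite mul1r.
Qed.

Lemma disc_scalarD x y X : disc (x%:M + y *: X) = y ^+ 2 * disc X.
Proof.
rewrite [X]mx2P mx2_scalar mx2Z mx2D !discE; ring.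
Qed.

(* Y is a conjugate of X in F[X], hence X or its conjugate (\tr X)%:M - X;    *)
(* in the latter case H anticommutes with 2X - (\tr X)%:M, so \tr H = 0.      *)
Lemma commute_conj_mx2 X Y H K : 2%:R != 0 :> F -> disc X != 0 -> \tr H != 0 ->
  H *m K = 1%:M -> Y = H *m X *m K -> X *m Y = Y *m X -> X *m H = H *m X.
Proof.
move=> two0 dX trH HK YE /(commute_mx2 dX)[x [y YE']].
have HX : H *m X = Y *m H by rewrite YE -mulmxA (mulmx1C HK) mulmx1.
have trY : \tr Y = \tr X by rewrite YE mxtrace_mulC mulmxA (mulmx1C HK) mul1mx.
have : disc Y = disc X by rewrite YE disc_conj.
rewrite YE' disc_scalarD => dy.
have /eqP : y ^+ 2 = 1 by apply: (mulIf dX); rewrite dy mul1r.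
rewrite sqrf_eq1 => /orP[] /eqP y1; move: trY; rewrite YE' y1.
  rewrite scale1r mxtraceD mxtrace_scalar => /eqP; rewrite -subr_eq0 addrK.
  rewrite -mulr_natr mulf_eq0 (negPf two0) orbF => /eqP x0.
  by rewrite HX YE' y1 x0 scale1r raddf0 add0r.
rewrite scaleN1r linearB /= mxtrace_scalar => /eqP; rewrite subr_eq => /eqP E.
have {}E : x = \tr X by apply: (mulIf two0); rewrite !mulr_natr E.
pose Z := 2%:R *: X - x%:M.
have HZ : H *m Z = - (Z *m H).
  rewrite mulmxBr mulmxBl -scalemxAr -scalemxAl HX YE' y1.
  rewrite mul_mx_scalar mul_scalar_mx scaleN1r mulmxBl mul_scalar_mx opprB.
  by rewrite scalerBr addrAC scaler_nat mulrS addrK.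
have ZZ : Z *m Z = (disc X)%:M.
  rewrite /Z E [X]mx2P mx2_tr !mx2_scalar -scaleN1r !mx2Z mx2D mx2M discE.
  move: (X 0 0) (X 0 1) (X 1 0) (X 1 1) => a b c d.
  by congr mx2; ring.
have : disc X * \tr H = - (disc X * \tr H).
  rewrite -mxtraceZ -mul_mx_scalar -ZZ mulmxA {1}HZ mulNmx linearN /=.
  by rewrite -(mulmxA Z) (mxtrace_mulC Z).
move/eqP; rewrite -subr_eq0 opprK -mulr2n -mulr_natr !mulf_eq0.
by rewrite (negPf dX) (negPf trH) (negPf two0).
Qed.
End Commutation.

(** * The linear representation of a free product *)

Section Dilation.
Variables (F : fieldType) (iota : {rmorphism {poly rat} -> F}).
Hypothesis iota_inj : injective iota.
Local Open Scope ring_scope.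

Lemma iota_eq0 p : (iota p == 0) = (p == 0).
Proof. by rewrite -(inj_eq iota_inj) rmorph0. Qed.

(** With s for ['X], this is 2s times the matrix with eigenvector (r+s,1) for u and (r-s,1) for
    1. *)
Definition dilation_num (r u : rat) : 'M[{poly rat}]_2 :=
  mx2 ((u + 1)%:P * 'X + ((u - 1) * r)%:P)
      ((u - 1)%:P * ('X ^+ 2 - (r ^+ 2)%:P))
      (u - 1)%:P ((u + 1)%:P * 'X - ((u - 1) * r)%:P).

Definition dilation (r u : rat) : 'M[F]_2 :=
  (iota (2%:R * 'X))^-1 *: map_mx iota (dilation_num r u).

Lemma dilation_numM r u v :
  dilation_num r u *m dilation_num r v = (2%:R * 'X) *: dilation_num r (u * v).
Proof.
rewrite mx2M mx2Z !(polyCD, polyCN, polyCM, rmorphXn) /=; congr mx2; ring.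
Qed.

(** At s = 0 the two eigenvectors collide, leaving a multiple of the rank one matrix (r,1)^T
    (1,-r). *)
Lemma dilation_num_at0 r u : map_mx (horner_eval 0) (dilation_num r u) =
  (u - 1) *: mx2 r (- (r * r)) 1 (- r).
Proof. by rewrite map_mx2 mx2Z /horner_eval !hornerE; congr mx2; ring. Qed.

Lemma twoX_neq0 : iota (2%:R * 'X) != 0.
Proof. by rewrite iota_eq0 mulf_neq0 ?polyX_eq0 // -polyC_natr polyC_eq0. Qed.

Lemma dilationM r u v : dilation r u *m dilation r v = dilation r (u * v).
Proof.
rewrite -scalemxAl -scalemxAr -map_mxM dilation_numM map_mxZ scalerA scalerA.
by rewrite mulVf ?twoX_neq0 // mulr1.
Qed.

Lemma dilation1 r : dilation r 1 = 1%:M.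
Proof.
rewrite /dilation /dilation_num subrr mul0r polyC0 !mul0r addr0 subr0.
rewrite map_mx2 mx2Z mx2_scalar rmorph0 mulr0; congr mx2;
by rewrite -[1 + 1]/(2%:R) polyC_natr mulVf ?twoX_neq0.
Qed.

Lemma dilation_tr r u : \tr (dilation r u) = iota (u + 1)%:P.
Proof.
rewrite mxtraceZ trace_map_mx /dilation_num mx2_tr.
apply: (mulfI twoX_neq0); rewrite mulVKf ?twoX_neq0 // -rmorphM.
by congr (iota _); ring.
Qed.

Lemma disc_map (R S : comNzRingType) (f : {rmorphism R -> S}) M :
  disc (map_mx f M) = f (disc M).
Proof.
by rewrite /disc trace_map_mx det_map_mx rmorphB rmorphXn rmorphM rmorph_nat.
Qed.

Lemma discZ (R : comNzRingType) (x : R) M : disc (x *: M) = x ^+ 2 * disc M.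
Proof. by rewrite [M]mx2P mx2Z !discE; ring. Qed.

Lemma dilation_disc r u : disc (dilation r u) = iota ((u - 1) ^+ 2)%:P.
Proof.
rewrite discZ disc_map discE.
apply: (mulfI (expf_neq0 2 twoX_neq0)).
rewrite exprVn mulVKf ?expf_neq0 ?twoX_neq0 // -rmorphXn -rmorphM.
by congr (iota _); rewrite !(polyCD, polyCN, polyCM, rmorphXn) /=; ring.
Qed.

Local Close Scope ring_scope.
Variables (G : groupType) (k : nat) (Gs : 'I_k -> set G).
Hypothesis GsP : is_free_product Gs.
Variable u : 'I_k -> G -> rat.
Hypothesis u_gt0 : forall i x, (0 < u i x)%R.
Hypothesis uM : forall i x y, Gs i x -> Gs i y ->
  u i (x * y) = (u i x * u i y)%R.

Lemma dilationK (r t : rat) : (0 < t)%R ->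
  cancel (mulmx (dilation r t) : 'M_2 -> 'M_2) (mulmx (dilation r t^-1)%R).
Proof.
move=> t_gt0 M; rewrite mulmxA dilationM mulVf ?gt_eqF // dilation1.
exact: mul1mx.
Qed.

Definition dilation_sym (r t : rat) (t_gt0 : (0 < t)%R) : sym 'M[F]_2.
Proof.
exists (mulmx (dilation r t)) (mulmx (dilation r t^-1)%R).
  exact: dilationK.
by rewrite -{2}[t]invrK; apply: dilationK; rewrite invr_gt0.
Defined.

(** The factors act on matrices by left multiplication. By induction every element then acts as
    multiplication by its image of the identity matrix, which is taken as [rho g]. *)
Lemma free_product_rep : exists rho : G -> 'M[F]_2,
  [/\ rho 1 = 1%:M%R, {morph rho : x y / x * y >-> (x *m y)%R} &
      forall i x, Gs i x -> rho x = dilation i%:R (u i x)].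
Proof.
have [sGs univ] := GsP.
have [i x y /set_mem Gx /set_mem Gy|f [[fM fi] _]] :=
    univ _ (fun i x => dilation_sym (val i)%:R (u_gt0 i x)).
  by apply: symP => M; rewrite /= uM // -dilationM mulmxA.
have fE g M : f g M = (f g 1%:M *m M)%R.
  move: g M; apply: (free_product_ind GsP) => [M|i x g Gx IH M].
    by rewrite (hom_on1 (@is_subgroupT G) fM) !sym1 mul1mx.
  by rewrite (hom_onM fM) // !symM (fi i x (mem_set Gx)) /= IH mulmxA.
exists (fun g => f g 1%:M%R); split=> [|x y|i x Gx].
- by rewrite (hom_on1 (@is_subgroupT G) fM).
- by rewrite (hom_onM fM) // symM fE.
- by rewrite (fi i x (mem_set Gx)) /= mulmx1.
Qed.
End Dilation.

(** * Reduced words in a free product *)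

Section ReducedWords.
Variables (G : groupType) (k : nat) (Gs : 'I_k -> set G).
Hypothesis sGs : forall i, is_subgroup (Gs i).
Implicit Types w : seq ('I_k * G).

Definition reduced w : Prop :=
  (forall p, p \in w -> Gs p.1 p.2 /\ p.2 <> 1) /\
  sorted (fun i j => i != j) (map fst w).

Definition word_prod w : G := foldr (fun p g => p.2 * g) 1 w.

Lemma word_prod_rcons w p : word_prod (rcons w p) = word_prod w * p.2.
Proof. by elim: w => [|q w IH] /=; rewrite ?mulg1 ?mul1g // IH mulgA. Qed.

Lemma reduced_cons p w : reduced (p :: w) -> reduced w.
Proof.
move=> [wP ws]; split; last exact: path_sorted ws.
by move=> q qw; apply: wP; rewrite inE qw orbT.
Qed.

Lemma reduced_rcons p w : reduced (rcons w p) -> reduced w.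
Proof.
move=> [wP]; rewrite map_rcons => ws; split; last first.
  by case: (map _ w) ws => //= i s; rewrite rcons_path => /andP[].
by move=> q qw; apply: wP; rewrite mem_rcons inE qw orbT.
Qed.

Lemma reduced_set_last i x y w : reduced (rcons w (i, x)) -> Gs i y -> y <> 1 ->
  reduced (rcons w (i, y)).
Proof.
move=> wr Gy y1; have [wP _] := reduced_rcons wr; case: wr => _.
rewrite map_rcons => ws; split; last by rewrite map_rcons.
by move=> q; rewrite mem_rcons inE => /orP[/eqP ->|/wP].
Qed.

Lemma reduced_mul i x w : Gs i x -> reduced w ->
  exists w', reduced w' /\ x * word_prod w = word_prod w'.
Proof.
move=> Gx wr; have [->|/eqP x1] := eqVneq x 1.
  by exists w; rewrite mul1g.
have [ji|ji] := boolP (ohead (map fst w) == Some i); last first.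
  exists ((i, x) :: w); split=> //; case: wr => wP ws; split=> [p|].
    by rewrite inE => /orP[/eqP ->|/wP].
  by case: w ws ji {wP} => //= -[j y] w /= ->; rewrite eq_sym andbT.
case: w wr ji => [|[j y] w] // wr /eqP [ji]; subst j => /=.
have w'r := reduced_cons wr; case: wr => wP ws.
have [Gy _] := wP (i, y) (mem_head _ _).
have [xy1|/eqP xy1] := eqVneq (x * y) 1.
  by exists w; rewrite mulgA xy1 mul1g.
exists ((i, x * y) :: w); rewrite mulgA; split=> //; split=> // p.
rewrite inE => /orP[/eqP ->|pw]; first by split=> //; exact: subgroupM.
by apply: wP; rewrite inE pw orbT.
Qed.

Lemma exists_reduced g : is_free_product Gs ->
  exists w, reduced w /\ g = word_prod w.
Proof.
move=> GsP; move: g; apply: (free_product_ind GsP) => [|i x g Gx [w [wr ->]]].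
  by exists [::].
exact: (reduced_mul Gx wr).
Qed.
End ReducedWords.

(** * Trace and discriminant of the image of a non-trivial element *)

Section Representation.
Variables (F : fieldType) (iota : {rmorphism {poly rat} -> F}).
Hypothesis iota_inj : injective iota.
Variables (G : groupType) (k : nat) (Gs : 'I_k -> set G).
Hypothesis GsP : is_free_product Gs.
Variable u : 'I_k -> G -> rat.
Hypothesis u_gt0 : forall i x, (0 < u i x)%R.
Hypothesis u_eq1 : forall i x, Gs i x -> u i x = 1%R -> x = 1.
Variable rho : G -> 'M[F]_2.
Hypothesis rho1 : rho 1 = 1%:M%R.
Hypothesis rhoM : {morph rho : x y / x * y >-> (x *m y)%R}.
Hypothesis rho_dilation : forall i x,
  Gs i x -> rho x = dilation iota i%:R%R (u i x).
Local Open Scope ring_scope.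

Definition word_num (w : seq ('I_k * G)) : 'M[{poly rat}]_2 :=
  foldr (fun (p : 'I_k * G) M => dilation_num p.1%:R (u p.1 p.2) *m M) 1%:M w.

Lemma rho_word w : reduced Gs w ->
  rho (word_prod w) =
    (iota (2%:R * 'X))^-1 ^+ size w *: map_mx iota (word_num w).
Proof.
elim: w => [_|[i x] w IH wr] /=; first by rewrite rho1 expr0 scale1r map_mx1.
rewrite rhoM IH; last exact: reduced_cons wr.
have [Gx _] := wr.1 _ (mem_head _ _); rewrite (rho_dilation Gx).
by rewrite -scalemxAl -scalemxAr -map_mxM scalerA exprS.
Qed.

(** In a product of rank one matrices the outer vectors survive, and neighbouring letters i, j
    contribute (1,-i)(j,1)^T = j - i, non-zero in a reduced word. *)
Lemma word_num_at0 i x w : reduced Gs ((i, x) :: w) ->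
  exists2 c, c != 0 & map_mx (horner_eval 0) (word_num ((i, x) :: w)) =
    let: j := last i (map fst w) in
    c *: mx2 i%:R (- i%:R * j%:R) 1 (- j%:R).
Proof.
elim: w i x => [|[j y] w IH] i x wr.
  have [Gx x1] := wr.1 _ (mem_head _ _).
  exists (u i x - 1); first by rewrite subr_eq0; apply/eqP => /(u_eq1 Gx).
  by rewrite /= mulmx1 dilation_num_at0 mulNr.
have [c c0 E] := IH _ _ (reduced_cons wr).
have [Gx x1] := wr.1 _ (mem_head _ _).
have ij : i != j by case/andP: wr.2.
exists ((u i x - 1) * (j%:R - i%:R) * c).
  rewrite !mulf_neq0 // subr_eq0; first by apply/eqP => /(u_eq1 Gx).
  by rewrite eqr_nat eq_sym.
rewrite (_ : word_num _ =
  dilation_num i%:R (u i x) *m word_num ((j, y) :: w)) //.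
rewrite map_mxM {}E /=.
rewrite dilation_num_at0 !mx2Z mx2M; by congr mx2; ring.
Qed.

Definition semiregular (M : 'M[F]_2) := (\tr M != 0) && (disc M != 0).

Lemma semiregular_conj M N X :
  M *m N = 1%:M -> semiregular (M *m X *m N) = semiregular X.
Proof.
move=> MN; rewrite /semiregular disc_conj //.
by rewrite mxtrace_mulC mulmxA (mulmx1C MN) mul1mx.
Qed.

(** If the extreme letters lie in different factors i and j, the values at 0 of trace and
    discriminant are, up to non-zero factors, i - j and its square. Otherwise conjugation by the
    first letter merges it with the last one and shortens the word. *)
Lemma rho_semiregular w : reduced Gs w -> w <> [::] ->
  semiregular (rho (word_prod w)).
Proof.
have [n] := ubnP (size w); elim: n w => // n IH [//|[i x] w] /= wn wr _.
have [Gx x1] := wr.1 _ (mem_head _ _).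
case/lastP: w wn wr => [|w [j y]] wn wr.
  (* A single letter has trace u + 1, non-zero by positivity of u, and discriminant (u - 1)^2. *)
  rewrite mulg1 (rho_dilation Gx) /semiregular (dilation_tr iota_inj).
  rewrite (dilation_disc iota_inj).
  rewrite !(iota_eq0 iota_inj) !polyC_eq0 gt_eqF ?addr_gt0 //= expf_neq0 //.
  rewrite subr_eq0.
  by apply/eqP => /(u_eq1 Gx).
have [ij|ij] := eqVneq i j; last first.
  have [c c0] := word_num_at0 wr; rewrite map_rcons last_rcons => E.
  rewrite (rho_word wr : rho (_ * _) = _) /semiregular mxtraceZ discZ.
  rewrite disc_map trace_map_mx !mulf_eq0 !expf_eq0 invr_eq0.
  rewrite (negPf (twoX_neq0 iota_inj)) !andbF /= !(iota_eq0 iota_inj).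
  have ij0 : i%:R - j%:R != 0 :> rat by rewrite subr_eq0 eqr_nat.
  apply/andP; split.
    have : horner_eval 0 (\tr (word_num ((i, x) :: rcons w (j, y)))) != 0.
      by rewrite -trace_map_mx E mxtraceZ mx2_tr mulf_neq0.
    by apply: contra_neq => ->; rewrite raddf0.
  have : horner_eval 0 (disc (word_num ((i, x) :: rcons w (j, y)))) != 0.
    rewrite -disc_map E discZ discE mulf_neq0 ?expf_neq0 //.
    rewrite [X in X != _](_ : _ = (i%:R - j%:R) ^+ 2) ?expf_neq0 //; ring.
  by apply: contra_neq => ->; rewrite raddf0.
subst j; rewrite word_prod_rcons /=.
have w'r := reduced_cons wr.
have [Gy y1] : Gs i y /\ y <> 1%g.
  by apply: (w'r.1 (i, y)); rewrite mem_rcons mem_head.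
have -> : (x * (word_prod w * y) = x * (word_prod w * (y * x)) * x^-1)%g.
  by rewrite !mulgA mulgK.
rewrite rhoM (rhoM x) semiregular_conj; last by rewrite -rhoM mulgV rho1.
have [yx1|/eqP yx1] := eqVneq (y * x)%g 1%g.
  rewrite yx1 mulg1; apply: IH; last first.
  - by move=> w0; move: wr => -[_]; rewrite w0 /= eqxx.
  - exact: reduced_rcons w'r.
  - by move: wn; rewrite size_rcons ltnS => /ltnW.
rewrite -[(y * x)%g]/((i, y * x)%g.2) -word_prod_rcons; apply: IH.
- by move: wn; rewrite !size_rcons.
- by apply: reduced_set_last w'r _ yx1; apply: subgroupM => //; case: GsP.
- by case: w {wn wr w'r}.
Qed.

Lemma rho_neq1_semiregular g : g <> 1%g -> semiregular (rho g).
Proof.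
move=> g1; have [sGs _] := GsP; have [w [wr gE]] := exists_reduced sGs g GsP.
by rewrite gE; apply: rho_semiregular => // w0; apply: g1; rewrite gE w0.
Qed.
End Representation.

Lemma free_product_Zn_rep (G : groupType) (k : nat) (n : 'I_k -> nat)
    (Gs : 'I_k -> set G) :
  is_free_product Gs -> (forall i, iso_to_Zn (n i) (Gs i)) ->
  exists (F : fieldType) (rho : G -> 'M[F]_2), (2%:R != 0 :> F)%R /\
    [/\ rho 1 = 1%:M%R, {morph rho : x y / x * y >-> (x *m y)%R},
        forall g, (\tr (rho g) != 0)%R &
        forall g, g <> 1 -> (disc (rho g) != 0)%R].
Proof.
move=> GsP GsZn.
have /choice[u uP] := fun i => iso_to_Zn_rat (GsZn i).
have u_gt0 i x : (0 < u i x)%R by case: (uP i).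
have uM i x y : Gs i x -> Gs i y -> u i (x * y) = (u i x * u i y)%R.
  by case: (uP i) => _ + _; exact.
have u1 i x : Gs i x -> u i x = 1%R -> x = 1 by case: (uP i) => _ _; exact.
suff: exists (F : fieldType) (iota : {rmorphism {poly rat} -> F}),
    injective iota /\ (2%:R != 0 :> F)%R.
  move=> [F [iota [iota_inj two0]]].
  have [rho [rho1 rhoM rhoE]] := free_product_rep iota_inj GsP u_gt0 uM.
  have sr := rho_neq1_semiregular iota_inj GsP u_gt0 u1 rho1 rhoM rhoE.
  exists F, rho; split=> //; split=> // g; last by case/sr/andP.
  have [->|/eqP/sr/andP[]//] := eqVneq g 1.
  by rewrite rho1 mxtrace_scalar.
exists {fraction {poly rat}}, (@tofrac {poly rat}); split=> [p q /eqP|].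
  by rewrite tofrac_eq => /eqP.
by rewrite -(rmorph_nat (@tofrac {poly rat})) tofrac_eq0 -polyC_natr polyC_eq0.
Qed.

(** * Centralizers and malnormality in G *)

Section Commutation.
Variables (G : groupType) (k : nat) (n : 'I_k -> nat) (Gs : 'I_k -> set G).
Hypotheses (GsP : is_free_product Gs) (GsZn : forall i, iso_to_Zn (n i) (Gs i)).

(** [rho] is injective, because the identity matrix has discriminant 0; both claims are thus read
    off matrices. *)
Lemma free_product_Zn_commute :
  (forall x y z : G, x <> 1 -> commute x y -> commute x z -> commute y z) /\
  (forall x g : G, x <> 1 -> commute x (g * x * g^-1) -> commute x g).
Proof.
have [F [rho [two0 [rho1 rhoM tr0 disc0]]]] := free_product_Zn_rep GsP GsZn.
have rho_inj : injective rho.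
  move=> x y xy; apply/divg1_eq/eqP; case: eqP => // /disc0.
  rewrite rhoM xy -rhoM mulgV rho1 mx2_scalar discE subrr mulr0 mulr0 addr0.
  by rewrite expr0n eqxx.
have rho_comm x y : commute x y <-> (rho x *m rho y = rho y *m rho x)%R.
  by split=> [E|]; [rewrite -!rhoM E|rewrite -!rhoM => /rho_inj].
split=> [x y z x1|x g x1]; rewrite !rho_comm.
  by apply: commute_mx2_trans; exact: disc0.
apply: (@commute_conj_mx2 _ _ _ _ (rho g^-1) two0 (disc0 _ x1) (tr0 g)).
  by rewrite -rhoM mulgV rho1.
by rewrite !rhoM.
Qed.

Definition malnormal (C : set G) :=
  forall x g : G, C x -> x <> 1 -> C (g * x * g^-1) -> C g.

(** The centralizer of x is abelian and contains C, so it equals C by maximality; and g commutes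
    with x. *)
Lemma maximal_abelian_malnormal (C : set G) : maximal_abelian C -> malnormal C.
Proof.
move=> [sC abC maxC] x g Cx x1 Cgx.
have [comm_trans comm_conj] := free_product_Zn_commute.
have xg : commute x g by apply: comm_conj => //; apply: abC; exact: mem_set.
suff <- : [set y | commute x y] = C by [].
apply: maxC.
- apply: is_subgroupI => [|y|y z]; first exact: commute1.
    exact: commuteV.
  exact: commuteM.
- by move=> y z /set_mem xy /set_mem xz; apply: comm_trans xz.
- by move=> y Cy; apply: abC; exact: mem_set.
Qed.
End Commutation.

(** * Reduced forms in an amalgamated product *)

Section SymOn.
Variables (X : Type) (V : set X) (f g : X -> X).
Hypotheses (fV : forall x, V x -> V (f x)) (gV : forall x, V x -> V (g x)).
Hypotheses (fK : forall x, V x -> g (f x) = x).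
Hypotheses (gK : forall x, V x -> f (g x) = x).

(** Extending by the identity outside [V] avoids a subtype of valid normal forms. *)
Definition sym_on : sym X.
Proof.
exists (fun x => if `[< V x >] then f x else x)
       (fun x => if `[< V x >] then g x else x) => x.
- have [Vx|Vx] := pselect (V x); last by rewrite !asboolF.
  by rewrite (asboolT Vx) (asboolT (fV Vx)) fK.
- have [Vx|Vx] := pselect (V x); last by rewrite !asboolF.
  by rewrite (asboolT Vx) (asboolT (gV Vx)) gK.
Defined.
End SymOn.

Lemma malnormal_commute (G : groupType) (C : set G) x g :
  malnormal C -> C x -> x <> 1 -> commute g x -> C g.
Proof. by move=> malC Cx x1 gx; apply: (malC x) => //; rewrite gx mulgK. Qed.

Section Amalgam.
Variables (G : groupType) (A B C : set G).
Hypothesis GABC : is_amalgam A B C.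

Let sA : is_subgroup A. Proof. by case: GABC => [[]]. Qed.
Let sB : is_subgroup B. Proof. by case: GABC => [[]]. Qed.
Let sC : is_subgroup C. Proof. by case: GABC => [[]]. Qed.
Let CA : C `<=` A. Proof. by case: GABC => [[]]. Qed.
Let CB : C `<=` B. Proof. by case: GABC => [[]]. Qed.

Definition side (s : bool) : set G := if s then A else B.

Let sS s : is_subgroup (side s). Proof. by case: s. Qed.
Let CS s : C `<=` side s. Proof. by case: s. Qed.

Definition coset_rep (x : G) : G := xget 1 [set y | C (y * x^-1)].

Lemma coset_repP x : C (x * (coset_rep x)^-1).
Proof.
suff : C (coset_rep x * x^-1) by move/(subgroupV sC); rewrite invgM invgK.
apply: (@xgetPex _ _ [set y | C (y * x^-1)]); exists x.
by rewrite /= mulgV; exact: subgroup1.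
Qed.

Lemma coset_repM c x : C c -> coset_rep (c * x) = coset_rep x.
Proof.
move=> Cc; congr xget; apply/seteqP; split=> y /=; rewrite invgM mulgA.
  by apply: subgroupMr => //; exact: subgroupV.
by move=> Cyx; apply: subgroupM => //; exact: subgroupV.
Qed.

Lemma coset_repK x : coset_rep (coset_rep x) = coset_rep x.
Proof.
have := coset_repM (coset_rep x) (coset_repP x).
by rewrite mulgVK.
Qed.

Lemma side_coset_rep s x : side s x -> side s (coset_rep x).
Proof.
move=> Sx; have /CS-/(_ s) := coset_repP x.
by move/(subgroupMl (sS s) Sx)/(subgroup_invE (sS s)).
Qed.

Lemma C_coset_rep x : C (coset_rep x) -> C x.
Proof.
by move=> Cx; apply: subgroupMr (coset_repP x) => //; exact: subgroupV.
Qed.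

(* [(c, [:: (s1, x1); ...; (sn, xn)])] stands for c x1 ... xn, c in C and    *)
(* the xi representatives of right cosets of C, alternately in A (si = true)  *)
(* and B. Left multiplication by an element of A or B changes only c and the  *)
(* first letter.                                                              *)
Notation letter := (bool * G)%type.
Notation normal_form := (G * seq letter)%type.
Implicit Types (s : bool) (p : normal_form) (w : seq letter).

Definition valid_word w : Prop :=
  (forall q, q \in w -> [/\ side q.1 q.2, ~ C q.2 & coset_rep q.2 = q.2]) /\
  sorted (fun s t => s != t) (map fst w).

Definition valid p : Prop := C p.1 /\ valid_word p.2.

Definition first_side w : option bool := ohead (map fst w).

(** The image of the valid forms under [unfold s], which absorbs a first letter of side s into the
    head. There left multiplication by [side s] affects the head alone; [refold s] splits the head
    again. *)
Definition unfolded s p : Prop :=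
  [/\ side s p.1, valid_word p.2 & first_side p.2 <> Some s].

Definition unfold s p : normal_form :=
  if p.2 is (t, x) :: w then if t == s then (p.1 * x, w) else p else p.

Definition refold s p : normal_form :=
  if `[< C p.1 >] then p
  else (p.1 * (coset_rep p.1)^-1, (s, coset_rep p.1) :: p.2).

Lemma valid_word_cons q w : valid_word (q :: w) -> valid_word w.
Proof.
move=> [wP ws]; split; last exact: path_sorted ws.
by move=> r rw; apply: wP; rewrite inE rw orbT.
Qed.

Lemma unfold_valid s p : valid p -> unfolded s (unfold s p).
Proof.
case: p => c [|[t x] w] [/= Cc wv]; first by split => //; exact: CS.
have [ts|ts] := eqVneq t s; last first.
  rewrite /unfold /= (negPf ts).
  by split=> //=; [exact: CS|case=> /eqP; rewrite (negPf ts)].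
subst t; have [Sx _ _] := wv.1 _ (mem_head _ _).
rewrite /unfold /= eqxx; split=> /=.
- by apply: subgroupM Sx => //; exact: CS.
- exact: valid_word_cons wv.
- case: w wv => [|[t y] w] //= [_ /= /andP[st _]] [ts].
  by rewrite ts eqxx in st.
Qed.

Lemma refold_valid s p : unfolded s p -> valid (refold s p).
Proof.
case: p => x w [/= Sx [wP ws] fs]; rewrite /refold /=.
case: asboolP => [Cx|nCx]; first by split.
split; first exact: coset_repP.
split=> [q|/=]; last first.
  case: w ws fs {wP} => //= -[t y] w /= -> fs; rewrite andbT.
  by apply/eqP => st; apply: fs; rewrite st.
rewrite inE => /orP[/eqP ->|/wP] //; split; first exact: side_coset_rep.
  by move/C_coset_rep.
exact: coset_repK.
Qed.

Lemma refoldK s p : unfolded s p -> unfold s (refold s p) = p.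
Proof.
case: p => x w [/= Sx _ fs]; rewrite /refold /=.
case: asboolP => [Cx|nCx]; last by rewrite /unfold /= eqxx mulgVK.
case: w fs => [|[t y] w] //= fs; rewrite /unfold /=.
by case: eqVneq => // ts; rewrite ts in fs.
Qed.

Lemma unfoldK s p : valid p -> refold s (unfold s p) = p.
Proof.
case: p => c [|[t x] w] [/= Cc wv]; first by rewrite /refold /= asboolT.
rewrite /unfold /=.
have [ts|ts] := eqVneq t s; last by rewrite /refold /= asboolT.
subst t; have [Sx nCx rx] := wv.1 _ (mem_head _ _).
rewrite /refold asboolF /=; last by move/(subgroupMl sC Cc).
by rewrite coset_repM // rx mulgK.
Qed.

Definition act s (a : G) p : normal_form :=
  refold s (a * (unfold s p).1, (unfold s p).2).

Lemma unfolded_mul s a p :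
  side s a -> unfolded s p -> unfolded s (a * p.1, p.2).
Proof. by move=> Sa [? ? ?]; split=> //=; exact: subgroupM. Qed.

Lemma act_valid s a p : side s a -> valid p -> valid (act s a p).
Proof. by move=> Sa /(unfold_valid s)/(unfolded_mul Sa)/refold_valid. Qed.

Lemma actM s a b p : side s b -> valid p ->
  act s (a * b) p = act s a (act s b p).
Proof.
move=> Sb /(unfold_valid s)/(unfolded_mul Sb) up.
by rewrite /act refoldK //= mulgA.
Qed.

Lemma act1 s p : valid p -> act s 1 p = p.
Proof. by move=> vp; rewrite /act mul1g -surjective_pairing unfoldK. Qed.

(** The result does not depend on s: this is the compatibility on C needed to glue the two
    actions. *)
Lemma actC s c p : C c -> valid p -> act s c p = (c * p.1, p.2).
Proof.
move=> Cc vp; rewrite -{1}[p](unfoldK s vp) /act refoldK; last first.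
  exact: unfold_valid.
have [Cd _] := vp.
rewrite /refold /=; case: asboolP => [Cx|nCx].
  move: (subgroupMl sC Cc Cx) => {}Cx.
  by have := unfoldK s vp; rewrite /refold asboolT // => ->.
have {}nCx : ~ C (unfold s p).1 by move/(subgroupM sC Cc).
rewrite coset_repM // -mulgA.
by move: (unfoldK s vp); rewrite /refold asboolF // => E; rewrite -[in RHS]E.
Qed.

Lemma act_first s a p :
  side s a -> ~ C a -> valid p -> first_side p.2 <> Some s ->
  first_side (act s a p).2 = Some s.
Proof.
move=> Sa nCa [Cp _] ps; rewrite /act.
have -> : unfold s p = p.
  case: p ps Cp => c [|[t x] w] //= ts _; rewrite /unfold /=.
  by case: eqVneq => // E; rewrite E in ts.
by rewrite /refold asboolF //= => /(subgroupMr sC Cp).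
Qed.

Definition act_sym s a : sym normal_form :=
  if pselect (side s a) is left Sa then
    @sym_on _ valid (act s a) (act s a^-1)
      (fun p => act_valid Sa) (fun p => act_valid (subgroupV (sS s) Sa))
      (fun p vp => etrans (esym (actM a^-1 Sa vp))
         (etrans (congr1 (act s ^~ p) (mulVg a)) (act1 s vp)))
      (fun p vp => etrans (esym (actM a (subgroupV (sS s) Sa) vp))
         (etrans (congr1 (act s ^~ p) (mulgV a)) (act1 s vp)))
  else 1.

Lemma act_symE s a p : side s a -> valid p -> act_sym s a p = act s a p.
Proof.
by move=> Sa vp; rewrite /act_sym; case: pselect => //= ?; rewrite asboolT.
Qed.

Lemma act_sym_invalid s a p : ~ valid p -> act_sym s a p = p.
Proof.
by move=> vp; rewrite /act_sym; case: pselect => //= ?; rewrite asboolF.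
Qed.

Lemma amalgam_action : exists f : G -> sym normal_form,
  hom_on [set: G] f /\
  forall s a p, side s a -> valid p -> f a p = act s a p.
Proof.
have [_ univ] := GABC.
have homS s : hom_on (side s) (act_sym s).
  move=> a b /set_mem Sa /set_mem Sb; apply: symP => p.
  have [vp|vp] := pselect (valid p); last by rewrite symM !act_sym_invalid.
  rewrite symM !act_symE ?actM //; [exact: act_valid|exact: subgroupM].
have [c /set_mem Cc|f [[fM fA fB] _]] := univ _ _ _ (homS true) (homS false).
  apply: symP => p; have [vp|vp] := pselect (valid p).
    by rewrite !act_symE ?actC //; exact: CS.
  by rewrite !act_sym_invalid.
exists f; split=> // -[] a p Sa vp.
  by rewrite fA ?act_symE //; exact: mem_set.
by rewrite fB ?act_symE //; exact: mem_set.
Qed.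

(* The elements whose reduced form is [a0 b1 a1 ... bn] with n >= 1.          *)
Inductive ends_in_B : G -> Prop :=
| EndsInB1 a b : A a -> B b -> ~ C b -> ends_in_B (a * b)
| EndsInBS h a b : ends_in_B h -> A a -> ~ C a -> B b -> ~ C b ->
    ends_in_B (h * a * b).

Definition starts s p := valid p /\ first_side p.2 = Some s.

(** Elements act on the empty form [p0]. The inverse of h' yields a form starting in B; if y were
    outside C, applying y and then h would keep it non-empty, although h y h'^-1 = 1 fixes [p0]. If
    h lay in A, the form of its inverse would be empty or start in A. *)
Lemma ends_in_B_reduced :
  (forall h h' y, ends_in_B h -> ends_in_B h' -> A y -> h * y = h' -> C y) /\
  (forall h, ends_in_B h -> ~ A h).
Proof.
have [f [fM fE]] := amalgam_action.
have f1 : f 1 = 1 by apply: hom_on1 fM; exact: is_subgroupT.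
have {}fM x y p : f (x * y) p = f x (f y p) by rewrite (hom_onM fM).
pose p0 : normal_form := (1, [::]).
have p0s s : first_side p0.2 <> Some s by [].
have vp0 : valid p0 by split; [exact: subgroup1|split].
have startsP s a p : side s a -> ~ C a -> valid p -> first_side p.2 <> Some s ->
    starts s (f a p).
  move=> Sa nCa vp ps; rewrite (fE s) //; split; first exact: act_valid.
  exact: act_first.
have startsI h : ends_in_B h -> starts false (f h^-1 p0).
  elim=> [a b Aa Bb nCb|{}h a b _ IH Aa nCa Bb nCb]; rewrite !invgM !fM.
    have Aa' : side true a^-1 by exact: subgroupV.
    apply: (startsP); [exact: (subgroupV sB)|by move/(subgroup_invE sC)|..].
      by rewrite (fE true) //; exact: act_valid.
    have [Ca|nCa] := pselect (C a^-1); first by rewrite (fE true) // actC.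
    by have [_ ->] := startsP _ _ _ Aa' nCa vp0 (p0s _).
  have [v1 s1] : starts true (f a^-1 (f h^-1 p0)).
    case: IH => vh sh; apply: (startsP) => //; last by rewrite sh.
      exact: (subgroupV sA).
    by move/(subgroup_invE sC).
  apply: (startsP) => //; last by rewrite s1.
    exact: (subgroupV sB).
  by move/(subgroup_invE sC).
have startsB p a b : valid p -> first_side p.2 <> Some false ->
    A a -> B b -> ~ C b -> exists s, starts s (f (a * b) p).
  move=> vp ps Aa Bb nCb; rewrite fM.
  have [vb sb] : starts false (f b p) by exact: (startsP).
  have [Ca|nCa] := pselect (C a).
    exists false; split.
      by rewrite (fE true) //; exact: (@act_valid true).
    by rewrite (fE true) // actC.
  by exists true; apply: (startsP) => //; rewrite sb.
have startsA h p : ends_in_B h -> starts true p -> exists s, starts s (f h p).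
  move=> hB; elim: hB p => [a b Aa Bb nCb|{}h a b _ IH Aa nCa Bb nCb] p [vp sp].
    by apply: startsB => //; rewrite sp.
  rewrite !fM; apply: IH.
  have [vb sb] : starts false (f b p) by apply: (startsP) => //; rewrite sp.
  by apply: (startsP) => //; rewrite sb.
split=> [h h' y hB h'B Ay hy|h hB Ah].
  apply: contrapT => nCy.
  have [v1 s1] := startsI _ h'B.
  have : starts true (f y (f h'^-1 p0)) by apply: (startsP) => //; rewrite s1.
  by case/(startsA _ _ hB) => s []; rewrite -!fM hy mulgV f1.
have [_] := startsI _ hB; have Ah' : side true h^-1 by exact: (subgroupV sA).
have [Ch|nCh] := pselect (C h^-1); first by rewrite (fE true) // actC.
by have [_ ->] := startsP _ _ _ Ah' nCh vp0 (p0s _).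
Qed.

Lemma amalgam_cap x : A x -> B x -> C x.
Proof.
move=> Ax Bx; apply: contrapT => nCx; apply: (ends_in_B_reduced.2 x) => //.
by rewrite -[x]mul1g; apply: EndsInB1 => //; exact: subgroup1.
Qed.

Lemma amalgam_reduced_form g :
  A g \/ exists h a, [/\ ends_in_B h, A a & g = h * a].
Proof.
move: g; apply: (amalgam_ind GABC) => [|x g Ax [Ag|[h [a [hB Aa ->]]]]|].
- by left; exact: subgroup1.
- by left; exact: subgroupM.
- by right; exists h, (a * x); rewrite mulgA; split=> //; exact: subgroupM.
move=> x g Bx; have [Cx|nCx] := pselect (C x).
  case=> [Ag|[h [a [hB Aa ->]]]]; [left|right].
    by apply: subgroupM => //; exact: CA.
  exists h, (a * x); rewrite mulgA; split=> //.
  by apply: subgroupM => //; exact: CA.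
case=> [Ag|[h [a [hB Aa ->]]]].
  right; exists (g * x), 1; rewrite mulg1; split=> //; first exact: EndsInB1.
  exact: subgroup1.
have [Ca|nCa] := pselect (C a); last first.
  right; exists (h * a * x), 1; rewrite mulg1; split=> //.
    exact: EndsInBS.
  exact: subgroup1.
(* As [a] is in C, x merges with the last B letter; if the merged letter falls into C, it is
   absorbed by what precedes it. *)
case: hB => [a1 b1 Aa1 Bb1 _|{}h a1 b1 hB Aa1 nCa1 Bb1 _]; rewrite -!mulgA;
  have Bbax : B (b1 * (a * x)) by do ?[apply: subgroupM => //]; exact: CB.
  have [C1|nC1] := pselect (C (b1 * (a * x))).
    by left; apply: subgroupM => //; exact: CA.
  right; exists (a1 * (b1 * (a * x))), 1; rewrite mulg1; split=> //.
    exact: EndsInB1.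
  exact: subgroup1.
right; have [C1|nC1] := pselect (C (b1 * (a * x))).
  exists h, (a1 * (b1 * (a * x))); split=> //.
  by apply: subgroupM => //; exact: CA.
exists (h * a1 * (b1 * (a * x))), 1; rewrite mulg1 !mulgA; split=> //.
  by rewrite -!mulgA mulgA; exact: EndsInBS.
exact: subgroup1.
Qed.

Lemma ends_in_B_mulA x h : A x -> ends_in_B h -> ends_in_B (x * h).
Proof.
move=> Ax; elim=> [a b Aa Bb nCb|{}h a b hB IH Aa nCa Bb nCb]; rewrite !mulgA.
  by apply: EndsInB1 => //; exact: subgroupM.
exact: EndsInBS.
Qed.

Lemma ends_in_B_mulC h c : ends_in_B h -> C c -> ends_in_B (h * c).
Proof.
move=> hB Cc.
have nC b : ~ C b -> ~ C (b * c) by move=> nCb /(subgroupMr sC Cc).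
case: hB => [a b Aa Bb nCb|{}h a b hB Aa nCa Bb nCb]; rewrite -mulgA.
  by apply: EndsInB1 => //; [apply: subgroupM => //; exact: CB|exact: nC].
by apply: EndsInBS => //; [apply: subgroupM => //; exact: CB|exact: nC].
Qed.

(** * Solutions g of d g = x g x^-1 *)

Section Twist.
Variables (c0 : G) (d : G -> G).
Hypotheses (Cc0 : C c0) (c0_neq1 : c0 <> 1) (malC : malnormal C).
Hypotheses (dM : {morph d : x y / x * y}) (dA : forall a, A a -> d a = a)
  (dB : forall b, B b -> d b = c0 * b * c0^-1).

Let Ac0 : A c0. Proof. exact: CA. Qed.

(** Each b becomes c0 b c0^-1, and these factors are absorbed by the neighbouring A letters, except
    for a final c0^-1, which [c0] cancels. *)
Lemma twist_ends_in_B h : ends_in_B h -> ends_in_B (d h * c0).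
Proof.
elim=> [a b Aa Bb nCb|{}h a b _ IH Aa nCa Bb nCb]; rewrite !dM (dA Aa) (dB Bb).
  rewrite !mulgA mulgVK; apply: EndsInB1 => //; exact: subgroupM.
have -> : d h * a * (c0 * b * c0^-1) * c0 = d h * c0 * (c0^-1 * a * c0) * b.
  by rewrite !mulgA mulgVK mulgK.
have Ac0V := subgroupV sA Ac0; have Cc0V := subgroupV sC Cc0.
apply: EndsInBS => //; first by do ?apply: subgroupM => //.
by move/(subgroupMr sC Cc0)/(subgroupMl sC Cc0V).
Qed.

(** The equation reads (x h)(a x^-1 a^-1 c0) = d h c0, where x h and d h c0 both end in B; so the
    middle element of A lies in C. *)
Lemma twist_conj_last x h a : A x -> ends_in_B h -> A a ->
  d (h * a) = x * (h * a) * x^-1 -> C (a * x * a^-1).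
Proof.
move=> Ax hB Aa; rewrite dM (dA Aa) => dh.
have [AxV AaV Ac0V] : [/\ A x^-1, A a^-1 & A c0^-1] by split; exact: subgroupV.
have : C (a * x^-1 * a^-1 * c0).
  apply: (ends_in_B_reduced.1 _ _ _ (ends_in_B_mulA Ax hB)
    (twist_ends_in_B hB)).
    by do ?apply: subgroupM => //.
  by rewrite -[d h](mulgK a) dh !mulgA.
move/(subgroupMr sC Cc0) => Cx; apply: subgroup_invE => //.
by rewrite !invgM invgK mulgA.
Qed.

Lemma twist_conj_C x g : A x -> ~ A g -> d g = x * g * x^-1 ->
  exists2 a, A a & C (a * x * a^-1).
Proof.
move=> Ax nAg dg; have [//|[h [a [hB Aa gE]]]] := amalgam_reduced_form g.
by exists a => //; apply: twist_conj_last Ax hB Aa _; rewrite -gE.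
Qed.

(** By malnormality g itself ends in B. Let b be its last letter. If x <> c0, then b x^-1 c0 b^-1 is
    in B but not in C, so one side of the rearranged equation ends in B and the other does not.
    Hence x = c0. *)
Lemma twist_conj_B x g : C x -> x <> 1 -> ~ A g -> d g = x * g * x^-1 ->
  x = c0 /\ B g.
Proof.
move=> Cx x1 nAg; have [//|[h' [a' [hB Aa gE]]] dg] := amalgam_reduced_form g.
have Ax := CA Cx.
have Ca : C a'.
  by apply: (malC Cx x1); apply: twist_conj_last Ax hB Aa _; rewrite -gE.
have {h' a' hB Aa gE Ca} gB : ends_in_B g by rewrite gE; exact: ends_in_B_mulC.
have [CxV Cc0V] : C x^-1 /\ C c0^-1 by split; exact: subgroupV.
have BC b : B b -> ~ C b -> x <> c0 ->
    B (b * (x^-1 * c0) * b^-1) /\ ~ C (b * (x^-1 * c0) * b^-1).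
  move=> Bb nCb xc0; have Cz := subgroupM sC CxV Cc0.
  split.
    exact: (subgroupM sB (subgroupM sB Bb (CB Cz)) (subgroupV sB Bb)).
  have z1 : x^-1 * c0 <> 1 by move/mulg1_eq; rewrite invgK.
  by move/(malC Cz z1).
case: gB dg {nAg} => [a b Aa Bb nCb|h a b hB Aa nCa Bb nCb].
  rewrite dM (dA Aa) (dB Bb) => E.
  have {}E : a * c0 = x * a * (b * (x^-1 * c0) * b^-1).
    have -> : a * c0 = a * (c0 * b * c0^-1) * (c0 * b^-1).
      by rewrite !mulgA mulgVK mulgK.
    by rewrite E !mulgA.
  have xc0 : x = c0.
    apply: contrapT => xc0; have [Bz nCz] := BC _ Bb nCb xc0.
    apply: (ends_in_B_reduced.2 (x * a * (b * (x^-1 * c0) * b^-1))).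
      by apply: EndsInB1 => //; exact: subgroupM.
    by rewrite -E; exact: subgroupM.
  split=> //; apply: subgroupM => //; apply: CB; apply: (malC Cc0 c0_neq1).
  by move: E; rewrite xc0 mulVg mulg1 mulgV mulg1 => ->; rewrite mulgK.
rewrite !dM (dA Aa) (dB Bb) => E.
have {}E : d h * c0 * (c0^-1 * a * c0) = x * h * a * (b * (x^-1 * c0) * b^-1).
  have -> : d h * c0 * (c0^-1 * a * c0) =
      d h * a * (c0 * b * c0^-1) * (c0 * b^-1).
    by rewrite !mulgA mulgVK !mulgK.
  by rewrite E !mulgA.
have Ac0V := subgroupV sA Ac0.
have Aac : A (c0^-1 * a * c0) by do ?apply: subgroupM => //.
have dhB := twist_ends_in_B hB.
have xc0 : x = c0.
  apply: contrapT => xc0; have [Bz nCz] := BC _ Bb nCb xc0.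
  apply: (nCa); apply: (subgroupMl sC Cc0V).
  apply: (subgroupMr sC Cc0).
  apply: (ends_in_B_reduced.1 _ _ _ dhB _ Aac E).
  by apply: EndsInBS => //; exact: ends_in_B_mulA.
(* For x = c0, comparing reduced forms puts a c0^-1 a^-1 c0 in C, hence a in C by malnormality: only
   forms with a single B letter remain. *)
case: nCa; apply: (malC Cc0 c0_neq1); apply: (subgroup_invE sC).
rewrite !invgM invgK mulgA; apply: (subgroupMr sC Cc0).
move: E; rewrite xc0 mulVg mulg1 mulgV mulg1 => E.
apply: (ends_in_B_reduced.1 _ _ _ (ends_in_B_mulA Ac0 hB) dhB).
  by do ?apply: subgroupM => //; exact: (subgroupV sA).
by rewrite -[RHS](mulgK (c0^-1 * a * c0)) E !invgM invgK !mulgA.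
Qed.

Lemma twist_conj_c0_B g : d g = c0 * g * c0^-1 -> B g.
Proof.
move=> dg; have [Ag|nAg] := pselect (A g); last first.
  by have [] := twist_conj_B Cc0 c0_neq1 nAg dg.
apply: CB; apply: (malnormal_commute malC Cc0 c0_neq1).
by rewrite /commute -{1}(dA Ag) dg mulgVK.
Qed.
End Twist.
End Amalgam.

(** * Conjugacy of twists *)

Lemma amalgam_hom_ext (G H : groupType) (A B C : set G) (f g : G -> H) :
  is_amalgam A B C -> {morph f : x y / x * y} -> {morph g : x y / x * y} ->
  (forall a, A a -> f a = g a) -> (forall b, B b -> f b = g b) -> f =1 g.
Proof.
move=> [_ univ] fM gM fgA fgB.
have homf D : hom_on D f by move=> x y _ _; exact: fM.
have homg D : hom_on D g by move=> x y _ _; exact: gM.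
have [F [_ Fu]] := univ _ _ _ (homf A) (homf B) (fun _ _ => erefl).
have -> : f = F by apply/esym/Fu; split=> //; exact: homf.
suff -> : g = F by [].
apply/esym/Fu; split=> [|x /set_mem Ax|x /set_mem Bx].
- exact: homg.
- exact/esym/fgA.
- exact/esym/fgB.
Qed.

Lemma morph_hom_on (G H : groupType) (f : G -> H) :
  hom_on [set: G] f -> {morph f : x y / x * y}.
Proof. by move=> fM x y; apply: fM; rewrite inE. Qed.

Lemma iso_on_inv (G H : groupType) (A : set G) (A' : set H) (f : G -> H) :
  is_subgroup A -> iso_on A A' f ->
  exists g : H -> G, [/\ hom_on A' g, forall x, A x -> A' (f x) /\ g (f x) = x &
    forall y, A' y -> A (g y) /\ f (g y) = y].
Proof.
move=> sA [fM fbij]; have [fA _ _] := fbij; have [g [fK gK]] := set_bijK 1 fbij.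
exists g; split=> // [x y /set_mem Ax /set_mem Ay|x Ax]; last first.
  by split; [exact: fA|exact: fK].
have [[Agx {1}<-] [Agy {1}<-]] := (gK _ Ax, gK _ Ay).
by rewrite -(hom_onM fM Agx Agy) fK //; exact: subgroupM.
Qed.

Lemma bij_automorphism (G : groupType) (p q : G -> G) :
  {morph p : x y / x * y} -> cancel p q -> cancel q p -> automorphism p.
Proof.
move=> pM pK qK; split; first by move=> x y _ _; exact: pM.
split=> [//|x y _ _ /(can_inj pK)//|y _]; by exists (q y).
Qed.

Lemma amalgam_map (G H : groupType) (A B C : set G) (f g : G -> H) :
  is_amalgam A B C -> hom_on A f -> hom_on B g -> {in C, f =1 g} ->
  exists F : G -> H, [/\ {morph F : x y / x * y},
    forall a, A a -> F a = f a & forall b, B b -> F b = g b].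
Proof.
move=> [_ univ] fM gM fg; have [F [[FM FA FB] _]] := univ _ _ _ fM gM fg.
exists F; split=> [|a Aa|b Bb]; first exact: morph_hom_on.
  by apply: FA; exact: mem_set.
by apply: FB; exact: mem_set.
Qed.

(** * Gluing the two isomorphisms into a conjugator *)

Section Converse.
Variables (G : groupType) (A B C A' B' C' : set G) (c0 c0' : G).
Variables (d d' phiA phiB : G -> G).
Hypotheses (d_twist : separating_Dehn_twist A B C c0 d).
Hypotheses (d'_twist : separating_Dehn_twist A' B' C' c0' d').
Hypotheses (isoA : iso_on A A' phiA) (isoB : iso_on B B' phiB).
Hypotheses (phiAC : phiA @` C = C') (phiABC : {in C, phiA =1 phiB}).
Hypothesis phic0 : phiA c0 = c0'.

Lemma twist_conjugate : conjugate_in_Aut d d'.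
Proof.
have [[GABC _ /set_mem Cc0] [[dM _] dA dB]] := d_twist.
have [[GABC' _ _] [[d'M _] d'A d'B]] := d'_twist.
have [[sA sB sC CA CB] _] := GABC.
move: dM d'M => /morph_hom_on dM /morph_hom_on d'M.
have [psiA [psiAM psiAK phiAK]] := iso_on_inv sA isoA.
have [psiB [psiBM psiBK phiBK]] := iso_on_inv sB isoB.
have [p [pM pA pB]] := amalgam_map GABC isoA.1 isoB.1 phiABC.
have psiABC : {in C', psiA =1 psiB}.
  move=> y; rewrite inE -phiAC => -[x Cx <-].
  rewrite (psiAK _ (CA _ Cx)).2 phiABC ?inE //.
  by rewrite (psiBK _ (CB _ Cx)).2.
have [q [qM qA qB]] := amalgam_map GABC' psiAM psiBM psiABC.
have pK : cancel p q.
  apply: (amalgam_hom_ext GABC) => // [x y|a Aa|b Bb]; first by rewrite pM qM.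
    by have [Ap pa] := psiAK _ Aa; rewrite pA // qA.
  by have [Bp pb] := psiBK _ Bb; rewrite pB // qB.
have qK : cancel q p.
  apply: (amalgam_hom_ext GABC') => // [x y|a Aa|b Bb]; first by rewrite qM pM.
    by have [Ap pa] := phiAK _ Aa; rewrite qA // pA.
  by have [Bp pb] := phiBK _ Bb; rewrite qB // pB.
have d'p : d' \o p =1 p \o d.
  apply: (amalgam_hom_ext GABC) => [x y|x y|a Aa|b Bb] /=.
  - by rewrite pM d'M.
  - by rewrite dM pM.
  - have [Ap _] := psiAK _ Aa.
    by rewrite pA // d'A ?dA ?inE // pA.
  - have [Bp _] := psiBK _ Bb; have p1 : p 1 = 1.
      by apply: (@mulgI _ (p 1)); rewrite -pM !mulg1.
    have pV x : p x^-1 = (p x)^-1.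
      by apply: (@mulgI _ (p x)); rewrite -pM !mulgV.
    rewrite pB // d'B ?dB ?inE // !pM pV (pA c0) ?phic0 ?(pB b) //.
    exact: CA.
exists p, q; split=> // [|x]; first exact: bij_automorphism pK qK.
by rewrite /= -[in LHS](qK x); exact: d'p.
Qed.
End Converse.

(** For b in B' outside A', q b is outside A and is twisted by q c0'. So some a in A conjugates q
    c0' into C, and [twist_conj_B] applied to a (q b) a^-1 identifies the result as c0. *)
Lemma twist_conj_elements (G : groupType) (A B C A' B' C' : set G) (c0 c0' : G)
    (d d' p q : G -> G) :
  separating_Dehn_twist A B C c0 d -> standing_assumptions A B C c0 d ->
  separating_Dehn_twist A' B' C' c0' d' ->
  standing_assumptions A' B' C' c0' d' ->
  malnormal C -> {morph q : x y / x * y} -> cancel q p ->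
  (forall x, d (q x) = q (d' x)) -> (forall x, A (q x) <-> A' x) ->
  exists2 a, A a & a * q c0' * a^-1 = c0.
Proof.
move=> [[GABC _ /set_mem Cc0] [[/morph_hom_on dM _] dA dB]] [c01 _ _ _ _].
move=> [[GABC' abC' /set_mem Cc0'] [_ d'A d'B]] [c01' _ _ _ nabB'].
move=> malC qM qK dq Aq.
have q1 : q 1 = 1 by apply: (@mulgI _ (q 1)); rewrite -qM !mulg1.
have qV x : q x^-1 = (q x)^-1 by apply: (@mulgI _ (q x)); rewrite -qM !mulgV.
have [[sA sB sC CA CB] _] := GABC.
have [[sA' sB' sC' CA' CB'] _] := GABC'.
have {}dA a : A a -> d a = a by move=> Aa; apply: dA; exact: mem_set.
have {}dB b : B b -> d b = c0 * b * c0^-1.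
  by move=> Bb; apply: dB; exact: mem_set.
(* Otherwise B' would be contained in C' and hence be abelian. *)
have [b [B'b nA'b]] : exists b, B' b /\ ~ A' b.
  apply: contrapT => nex; apply: nabB' => x y /set_mem Bx /set_mem By.
  have BC z : B' z -> C' z.
    move=> Bz; apply: (amalgam_cap GABC') => //.
    by apply: contrapT => nAz; apply: nex; exists z.
  by apply: abC'; apply: mem_set; exact: BC.
have dqb : d (q b) = q c0' * q b * (q c0')^-1.
  by rewrite dq d'B ?inE // !qM qV.
have nAqb : ~ A (q b) by rewrite Aq.
have Aqc : A (q c0') by rewrite Aq; exact: CA'.
have [a Aa Cac] := twist_conj_C GABC Cc0 dM dA dB Aqc nAqb dqb.
exists a => //.
have ac1 : a * q c0' * a^-1 <> 1.
  move/divg1_eq => /(congr1 ( *%g a^-1)); rewrite mulKg mulVg -q1.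
  by move/(can_inj qK).
have aV := subgroupV sA Aa.
suff nA : ~ A (a * q b * a^-1).
  apply: (proj1 (twist_conj_B GABC Cc0 c01 malC dM dA dB Cac ac1 nA _)).
  by rewrite !dM dqb !(dA _ _) // !invgM invgK !mulgA !mulgVK.
by move=> /(subgroupMr sA aV)/(subgroupMl sA Aa).
Qed.

Lemma cancel_iso_on (G : groupType) (A A' : set G) (f g : G -> G) :
  {morph f : x y / x * y} -> cancel f g -> cancel g f ->
  (forall x, A x -> A' (f x)) -> (forall y, A' y -> A (g y)) -> iso_on A A' f.
Proof.
move=> fM fK gK fA gA; split; first by move=> x y _ _; exact: fM.
split=> [//|x y _ _ /(can_inj fK)//|y A'y].
by exists (g y); [exact: gA|exact: gK].
Qed.

Unset Implicit Arguments.

Theorem lemma3p11 (G : groupType) (k : nat) (n : 'I_k -> nat)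
    (Gs : 'I_k -> set G)
    (G_free_product : is_free_product Gs)
    (Gs_Zn : forall i : 'I_k, iso_to_Zn (n i) (Gs i))
    (delta delta' : G -> G)
    (A B C A' B' C' : set G) (c0 c0' : G)
    (delta_twist : separating_Dehn_twist A B C c0 delta)
    (delta_standing : standing_assumptions A B C c0 delta)
    (delta'_twist : separating_Dehn_twist A' B' C' c0' delta')
    (delta'_standing : standing_assumptions A' B' C' c0' delta') :
  conjugate_in_Aut delta delta' <->
  exists phiA phiB : G -> G,
    [/\ iso_on A A' phiA & iso_on B B' phiB] /\
    [/\ phiA @` C = C',
        phiB @` C = C',
        {in C, phiA =1 phiB} &
        phiA c0 = c0' /\ phiB c0 = c0'].
Proof.
split; last first.
  move=> [phiA [phiB [[isoA isoB] [phiAC _ phiABC [phic0 _]]]]].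
  exact: twist_conjugate delta_twist delta'_twist isoA isoB phiAC phiABC phic0.
move=> [p [q [[/morph_hom_on pM _] pK qK d'E]]].
have [[GABC abC /set_mem Cc0] [[/morph_hom_on dM _] dA dB]] := delta_twist.
have [c01 AE maxC _ _] := delta_standing.
have [[GABC' abC' /set_mem Cc0'] [[/morph_hom_on d'M _] d'A d'B]] :=
  delta'_twist.
have [c01' AE' maxC' _ _] := delta'_standing.
have malC := maximal_abelian_malnormal G_free_product Gs_Zn maxC.
have malC' := maximal_abelian_malnormal G_free_product Gs_Zn maxC'.
have [[sA sB sC CA CB] _] := GABC.
have qM : {morph q : x y / x * y}.
  by move=> x y; apply: (can_inj pK); rewrite pM !qK.
have dq x : delta (q x) = q (delta' x) by rewrite d'E /= pK.
have Aq x : A (q x) <-> A' x.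
  rewrite AE AE' /Fix /= dq; split=> [/(can_inj qK)//|->//].
have [a Aa ac0'] := twist_conj_elements delta_twist delta_standing delta'_twist
  delta'_standing malC qM qK dq Aq.
have {}dA x : A x -> delta x = x by move=> ?; apply: dA; exact: mem_set.
have {}d'A x : A' x -> delta' x = x by move=> ?; apply: d'A; exact: mem_set.
have {}dB x : B x -> delta x = c0 * x * c0^-1.
  by move=> ?; apply: dB; exact: mem_set.
have {}d'B x : B' x -> delta' x = c0' * x * c0'^-1.
  by move=> ?; apply: d'B; exact: mem_set.
have AaV := subgroupV sA Aa.
(* The twist [delta] fixes a, so this correction by an inner automorphism still intertwines the
   twists, and it now matches c0 with c0'. *)
pose phi x := p (a^-1 * x * a); pose psi y := a * q y * a^-1.
have phiM : {morph phi : x y / x * y}.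
  by move=> x y; rewrite /phi -pM !mulgA mulgK.
have psiM : {morph psi : x y / x * y}.
  by move=> x y; rewrite /psi qM !mulgA mulgVK.
have phiK : cancel phi psi.
  by move=> x; rewrite /phi /psi pK !mulgA mulgV mul1g mulgK.
have psiK : cancel psi phi.
  by move=> x; rewrite /phi /psi !mulgA mulVg mul1g mulgVK qK.
have psic0 : psi c0' = c0 := ac0'.
have phic0 : phi c0 = c0' by rewrite -psic0 psiK.
have d'phi x : delta' (phi x) = phi (delta x).
  by rewrite d'E /= /phi pK !dM !(dA a, dA a^-1).
have dpsi y : delta (psi y) = psi (delta' y).
  by rewrite -{2}(psiK y) d'phi phiK.
have psiA y : A' y -> A (psi y).
  by move=> /Aq Aqy; do ?apply: (subgroupM sA).
have phiA x : A x -> A' (phi x).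
  move=> Ax; rewrite -Aq /phi pK; by do ?apply: (subgroupM sA).
have morphV (f : G -> G) : {morph f : x y / x * y} ->
    forall x, f x^-1 = (f x)^-1.
  move=> fM x; apply: (hom_onV (is_subgroupT G)) => // y z _ _; exact: fM.
have psiB y : B' y -> B (psi y).
  move=> By; apply: (twist_conj_c0_B GABC Cc0 c01 malC dM dA dB).
  by rewrite dpsi d'B // !psiM (morphV _ psiM) psic0.
have phiB x : B x -> B' (phi x).
  move=> Bx; apply: (twist_conj_c0_B GABC' Cc0' c01' malC' d'M d'A d'B).
  by rewrite d'phi dB // !phiM (morphV _ phiM) phic0.
have phiC x : C x -> C' (phi x).
  move=> Cx; apply: (malnormal_commute malC' Cc0' c01').
  by rewrite /commute -phic0 -!phiM; congr phi; apply: abC; exact: mem_set.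
have psiC y : C' y -> C (psi y).
  move=> Cy; apply: (malnormal_commute malC Cc0 c01).
  by rewrite /commute -psic0 -!psiM; congr psi; apply: abC'; exact: mem_set.
have phiCE : phi @` C = C'.
  apply/seteqP; split=> [_ [x Cx <-]|y Cy]; first exact: phiC.
  by exists (psi y); [exact: psiC|exact: psiK].
exists phi, phi; split; first by split; exact: cancel_iso_on psiK _ _.
by split.
Qed.
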